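(* Let $2\leqslant k\leqslant n$ be integers. There exist a small constant $\delta_0>0$ depending only on $k$ and a sufficiently large constant $K>0$ (depending on $\delta_0$) such that for all $A>0$ and $s>0$ there is a constant $C>0$ depending only on $n,k,s,A$ with the following property. Let $\lambda=(\lambda_1,\dots,\lambda_n)\in\Gamma_k$ satisfy $\lambda_1\geqslant\lambda_2\geqslant\cdots\geqslant\lambda_n$, $\lambda_n>-A$, $\sigma_k(\lambda)=s$ and $\lambda_1\geqslant C$. Then for every vector $\xi=(\xi_1,\dots,\xi_n)\in\mathbb{R}^n$, $$-\sum_{p\neq q}\frac{\sigma_k^{pp,qq}\xi_p\xi_q}{\sigma_k}+K\frac{\big(\sum_i\sigma_k^{ii}\xi_i\big)^2}{\sigma_k^2}+2\sum_{i>1}\frac{\sigma_k^{ii}\xi_i^2}{(\lambda_1+A+1)\sigma_k}\geqslant(1+\delta_0)\frac{\sigma_k^{11}\xi_1^2}{\lambda_1\sigma_k}.$$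
   Context: $\sigma_m(\lambda)=\sum_{1\leqslant i_1<\cdots<i_m\leqslant n}\lambda_{i_1}\cdots\lambda_{i_m}$ is the $m$-th elementary symmetric polynomial and $\Gamma_k=\{\lambda\in\mathbb{R}^n:\sigma_j(\lambda)>0,\ j=1,\dots,k\}$. Notation: $\sigma_k=\sigma_k(\lambda)$, $\sigma_k^{pp}=\partial\sigma_k/\partial\lambda_p$ and $\sigma_k^{pp,qq}=\partial^2\sigma_k/\partial\lambda_p\partial\lambda_q$, all evaluated at $\lambda$. *)

(* Defs.v *)
From HB Require Import structures.
From mathcomp Require Import all_boot all_order all_algebra.
From mathcomp Require Import reals.
From mathcomp Require Import mpoly.

Set Implicit Arguments.
Unset Strict Implicit.
Unset Printing Implicit Defensive.

Import Order.TTheory GRing.Theory Num.Theory.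

Local Open Scope ring_scope.

(* Points of R^n are functions 'I_n -> R; indices start at 0, so the informal  *)
(* coordinate i corresponds to the ordinal i - 1.                             *)

Definition sigma (R : realType) (n m : nat) (lam : 'I_n -> R) : R :=
  (mesym n R m).@[lam].

Definition dsigma (R : realType) (n m : nat) (p : 'I_n) (lam : 'I_n -> R) : R :=
  ((mesym n R m)^`M(p)).@[lam].

Definition ddsigma (R : realType) (n m : nat) (p q : 'I_n) (lam : 'I_n -> R) :
    R :=
  (((mesym n R m)^`M(p))^`M(q)).@[lam].

Definition Gamma_cone (R : realType) (n k : nat) (lam : 'I_n -> R) : Prop :=
  forall j : nat, (1 <= j <= k)%N -> 0 < sigma j lam.

(* Main.v *)
Require Import Defs.
From mathcomp Require Import all_boot all_order all_algebra.
From mathcomp Require Import reals.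
From mathcomp Require Import mpoly ring lra.

Set Implicit Arguments.
Unset Strict Implicit.
Unset Printing Implicit Defensive.

Import Order.TTheory GRing.Theory Num.Theory.

Local Open Scope ring_scope.

(* Let lambda' be lambda without lambda_1, let g and q be sigma_(k-1) and
   sigma_k / sigma_(k-1) at lambda', and P = lambda_1 + q, so that
   sigma_k = g P.  Put D = dq(xi').  Since g^(1/(k-1)) is concave, the left hand
   side with K = 2 is at least
     ((1 + 1/k) (xi_1 + D)^2 / P - d^2q(xi', xi') + N) / P,
   where N comes from the sum over i > 1, while the right hand side is
   (1 + delta_0) xi_1^2 / (lambda_1 P).  By Cauchy-Schwarz it suffices that
     D^2 <= (E - c q) (- d^2q(xi', xi') + N)
   with a constant c < 1 and E small compared to lambda_1; recall that
   - lambda_1 < q because P > 0.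
   This bound is proved by induction from the identity
     k q(S) = sum_i x_i p_i / (x_i + p_i),  p_i = sigma_(k-1) / sigma_(k-2) (S \ i),
   behind the Marcus-Lopes concavity theorem.  For the coordinates x_i that are
   small compared to lambda_1 the bound of the i-th summand comes from the
   xi_i^2 term in N; for those comparable to lambda_1 it comes from the same
   bound for p_i.  Since sigma_k is fixed and lambda_n > -A, the k-th
   coordinate is bounded, so for lambda_1 large there is a gap among the first k
   coordinates separating the two kinds. *)

(** * Elementary symmetric polynomials of a set of coordinates *)

(** The ring is arbitrary so that the same identities serve for numbers, for the variables ['X_i]
    and for polynomials along a line; the set [S] allows coordinates to be deleted. *)
Definition elsym (A : comNzRingType) (I : finType) (x : I -> A) (S : {set I})
    (m : nat) : A :=
  \sum_(T : {set I} | (T \subset S) && (#|T| == m)) \prod_(i in T) x i.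

Section ElementarySymmetric.
Variables (A : comNzRingType) (I : finType).
Implicit Types (x : I -> A) (S : {set I}) (i : I) (m : nat).

Lemma setD1C S i j : S :\ i :\ j = S :\ j :\ i.
Proof. by apply/setP => t; rewrite !inE andbCA. Qed.

Lemma elsym0 x S : elsym x S 0 = 1.
Proof.
rewrite /elsym (big_pred1 set0) ?big_set0 // => T.
by rewrite /= cards_eq0; case: eqP => [->|_]; rewrite ?sub0set ?andbF.
Qed.

Lemma elsym_small x S m : (#|S| < m)%N -> elsym x S m = 0.
Proof.
move=> lt; rewrite /elsym big_pred0 // => T; apply/negP => /andP[/subset_leq_card h /eqP e].
by move: h; rewrite e leqNgt lt.
Qed.

Lemma elsym_del x S i m : i \in S ->
  elsym x S m.+1 = x i * elsym x (S :\ i) m + elsym x (S :\ i) m.+1.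
Proof.
move=> iS; rewrite {1}/elsym (bigID (fun T : {set I} => i \in T)) /=; congr (_ + _).
  rewrite /elsym big_distrr /=.
  rewrite (reindex_onto (fun T => i |: T) (fun T => T :\ i)) /=; last first.
    by move=> T /andP[_ iT]; rewrite setD1K.
  apply: eq_big => [T|T].
    rewrite subUset sub1set iS setU11 andbT /=.
    have [iT|iT] := boolP (i \in T).
      rewrite subsetD1 iT andbF /= andbC; apply/negbTE/nandP; left.
      by apply/eqP => /setP/(_ i); rewrite !inE eqxx iT.
    rewrite setU1K // eqxx andbT subsetD1 iT andbT cardsU1 iT add1n eqSS.
    by [].
  case/andP=> /andP[/andP[_ _] _] /eqP eT.
  have iT : i \notin T by rewrite -eT !inE eqxx.
  by rewrite big_setU1.
by apply: eq_bigl => T; rewrite subsetD1 -!andbA; congr (_ && _); rewrite andbC.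
Qed.

(** Each product over a set of size m + 1 arises once for each of its elements. *)
Lemma elsym_add1 x S m :
  \sum_(i in S) x i * elsym x (S :\ i) m = m.+1%:R * elsym x S m.+1.
Proof.
elim: {S}_.+1 {-2}S (ltnSn #|S|) m => // N IH S leS m.
have [->|/set0Pn[j jS]] := eqVneq S set0.
  by rewrite big_set0 elsym_small ?cards0 ?mulr0.
have leS' : (#|S :\ j| < N)%N by move: leS; rewrite (cardsD1 j S) jS.
rewrite (bigD1 j) //= (elsym_del x m jS) mulrDr.
under eq_bigl => i do rewrite andbC -in_setD1.
case: m => [|m].
  rewrite elsym0 !mul1r; congr (_ + _).
  under eq_bigr => i _ do rewrite elsym0 -(elsym0 x (S :\ j :\ i)).
  by rewrite IH // mul1r.
under eq_bigr => i.
  rewrite !inE => /andP[ij iS].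
  rewrite (@elsym_del _ _ j) ?inE 1?eq_sym ?ij // setD1C mulrDr mulrCA.
  over.
rewrite big_split /= -big_distrr /= !IH //.
by ring.
Qed.

Lemma elsym_sum_del x S m :
  \sum_(i in S) elsym x (S :\ i) m = (#|S|%:R - m%:R) * elsym x S m.
Proof.
case: m => [|m].
  by under eq_bigr do rewrite elsym0; rewrite elsym0 sumr_const subr0 mulr1.
have e : \sum_(i in S) elsym x S m.+1 =
    \sum_(i in S) (x i * elsym x (S :\ i) m + elsym x (S :\ i) m.+1).
  by apply: eq_bigr => i iS; rewrite -elsym_del.
move: e; rewrite big_split /= elsym_add1 sumr_const -[_ *+ #|_|]mulr_natl => e.
by rewrite mulrBl e; ring.
Qed.

End ElementarySymmetric.

Lemma elsym_morph (A B : comNzRingType) (I : finType) (f : {rmorphism A -> B})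
  (x : I -> A) S m : f (elsym x S m) = elsym (f \o x) S m.
Proof.
by rewrite rmorph_sum; apply: eq_bigr => T _; rewrite rmorph_prod.
Qed.

Lemma deriv_elsym (A : comNzRingType) (I : finType) (x : I -> {poly A}) S m :
  (elsym x S m.+1)^`() = \sum_(i in S) (x i)^`() * elsym x (S :\ i) m.
Proof.
elim: {S}_.+1 {-2}S (ltnSn #|S|) m => // N IH S leS m.
have [->|/set0Pn[j jS]] := eqVneq S set0.
  by rewrite big_set0 elsym_small ?cards0 // derivC.
have leS' : (#|S :\ j| < N)%N by move: leS; rewrite (cardsD1 j S) jS.
rewrite (elsym_del x m jS) derivD derivM (bigD1 j) //= -addrA; congr (_ + _).
under [in RHS]eq_bigl => i do rewrite andbC -in_setD1.
rewrite IH //; case: m => [|m].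
  rewrite elsym0 derivC mulr0 add0r.
  by apply: eq_bigr => i _; rewrite !elsym0.
under [in RHS]eq_bigr => i.
  rewrite !inE => /andP[ij iS].
  rewrite (@elsym_del _ _ _ _ j) ?inE 1?eq_sym ?ij // setD1C mulrDr mulrCA.
  over.
by rewrite big_split /= -big_distrr /= !IH.
Qed.

(** * Partial derivatives of the elementary symmetric polynomials *)

Section MelsymDerivatives.
Variables (n : nat) (R : comNzRingType).
Implicit Types (lam : 'I_n -> R) (S : {set 'I_n}).

Lemma mesym_elsym m : mesym n R m = elsym (fun i => 'X_i) setT m.
Proof. by rewrite /elsym; apply: eq_bigl => T; rewrite subsetT. Qed.

Lemma mderiv_elsym_notin p S m : p \notin S ->
  (elsym (fun i => 'X_i : {mpoly R[n]}) S m)^`M(p) = 0.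
Proof.
move=> pS; rewrite /elsym raddf_sum big1 // => T /andP[/subsetP TS _] /=.
apply: (big_ind (fun f : {mpoly R[n]} => f^`M(p) = 0)).
- by rewrite mderivC.
- by move=> f g f0 g0; rewrite mderivM f0 g0 mul0r mulr0 addr0.
- move=> i iT; rewrite mderivX mnmE.
  have /negbTE -> : i != p by apply: contraNneq pS => <-; apply: TS.
  by rewrite scale0r.
Qed.

Lemma mderiv_elsym p S m : p \in S ->
  (elsym (fun i => 'X_i : {mpoly R[n]}) S m.+1)^`M(p) =
  elsym (fun i => 'X_i) (S :\ p) m.
Proof.
move=> pS; rewrite (elsym_del _ _ pS) mderivD mderivM.
rewrite !mderiv_elsym_notin ?inE ?eqxx // mulr0 !addr0 mderivX mnmE eqxx.
have -> : (U_(p) - U_(p) = 0)%MM by apply/mnmP => i; rewrite mnmBE mnm0E subnn.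
by rewrite scale1r mpolyX0 mul1r.
Qed.

Lemma meval_elsym lam S m :
  (elsym (fun i => 'X_i) S m).@[lam] = elsym lam S m.
Proof.
rewrite /elsym raddf_sum; apply: eq_bigr => T _ /=.
by rewrite rmorph_prod; apply: eq_bigr => i _ /=; rewrite mevalXU.
Qed.
End MelsymDerivatives.

Section SigmaEsym.
Variables (R : realType) (n : nat) (lam : 'I_n -> R).

Lemma sigma_elsym m : sigma m lam = elsym lam setT m.
Proof. by rewrite /sigma mesym_elsym meval_elsym. Qed.

Lemma dsigma_elsym m p : dsigma m.+1 p lam = elsym lam [set~ p] m.
Proof. by rewrite /dsigma mesym_elsym mderiv_elsym ?inE // meval_elsym setTD. Qed.

Lemma ddsigma_elsym m p q : p != q ->
  ddsigma m.+2 p q lam = elsym lam ([set~ p] :\ q) m.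
Proof.
move=> pq; rewrite /ddsigma mesym_elsym mderiv_elsym ?inE // mderiv_elsym.
  by rewrite meval_elsym setTD.
by rewrite !inE eq_sym pq.
Qed.
End SigmaEsym.

(** * Newton's inequality and Garding cones *)

Section Newton.
Variables (R : realFieldType) (I : finType) (x : I -> R).
Implicit Types (S : {set I}) (i : I) (m : nat).

(** By [elsym_del] each summand equals e_(m+1)(S \ i) e_(m+1)(S) - e_m(S \ i) e_(m+2)(S), which is
    linear in the deleted polynomials, and [elsym_sum_del] sums those. *)
Lemma elsym_newton_sum S m :
  \sum_(i in S) (elsym x (S :\ i) m.+1 ^+ 2
                 - elsym x (S :\ i) m * elsym x (S :\ i) m.+2)
  = (#|S|%:R - m.+1%:R) * elsym x S m.+1 ^+ 2
    - (#|S|%:R - m%:R) * (elsym x S m * elsym x S m.+2).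
Proof.
transitivity (\sum_(i in S) (elsym x (S :\ i) m.+1 * elsym x S m.+1
                 - elsym x (S :\ i) m * elsym x S m.+2)).
  by apply: eq_bigr => i iS; rewrite !(elsym_del _ _ iS); ring.
by rewrite sumrB -!big_distrl /= !elsym_sum_del; ring.
Qed.

(** By induction the gaps of all S \ i are nonnegative, and so is their sum. It weights the product
    with |S| - m and the square with the smaller |S| - m - 1, which suffices when the product is
    positive. *)
Lemma elsym_newton S m :
  elsym x S m * elsym x S m.+2 <= elsym x S m.+1 ^+ 2.
Proof.
elim: {S}_.+1 {-2}S (ltnSn #|S|) m => // N IH S leS m.
have [lt|ge] := ltnP #|S| m.+2.
  by rewrite (@elsym_small _ _ _ _ m.+2) // mulr0 sqr_ge0.
have [le0|gt0] := lerP (elsym x S m * elsym x S m.+2) 0.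
  by apply: le_trans le0 (sqr_ge0 _).
have : 0 <= \sum_(i in S) (elsym x (S :\ i) m.+1 ^+ 2
                 - elsym x (S :\ i) m * elsym x (S :\ i) m.+2).
  apply: sumr_ge0 => i iS; rewrite subr_ge0; apply: IH.
  by move: leS; rewrite (cardsD1 i S) iS.
rewrite elsym_newton_sum.
have : (m.+2%:R : R) <= #|S|%:R by rewrite ler_nat.
rewrite -[m.+2%:R]natr1 -[m.+1%:R]natr1; nra.
Qed.

(** The same sum bounds e_(m+1)^2 by |S| - m times the gap; |S| + 1 is a factor valid for all m. *)
Lemma elsym_newton_strict S m :
  elsym x S m.+1 ^+ 2 <=
  (#|S|.+1)%:R * (elsym x S m.+1 ^+ 2 - elsym x S m * elsym x S m.+2).
Proof.
have nw := elsym_newton S m.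
have [lt|ge] := ltnP #|S| m.+1.
  by rewrite (@elsym_small _ _ _ _ m.+2 (leqW lt)) (elsym_small _ lt) expr0n !mulr0 subr0 mulr0.
have : 0 <= \sum_(i in S) (elsym x (S :\ i) m.+1 ^+ 2
                 - elsym x (S :\ i) m * elsym x (S :\ i) m.+2).
  by apply: sumr_ge0 => i iS; rewrite subr_ge0; apply: elsym_newton.
rewrite elsym_newton_sum.
have : (0 : R) <= m%:R by [].
rewrite -[#|S|.+1%:R]natr1 -[m.+1%:R]natr1; nra.
Qed.

(* [gamma_on S m] is the Garding cone of order [m] for the coordinates in [S];
   the index 0 is harmless because [elsym x S 0 = 1]. *)
Definition gamma_on S m := forall j, (j <= m)%N -> 0 < elsym x S j.

Lemma gamma_onW S m k : (k <= m)%N -> gamma_on S m -> gamma_on S k.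
Proof. by move=> km h j jk; apply: h; apply: leq_trans km. Qed.

(* If the first non-positive [e_(j+1)(S \ i)] had [j + 2 <= m + 1], positivity
   of [e_(j+1)(S)] and [e_(j+2)(S)] would contradict Newton's inequality. *)
Lemma gamma_on_del S i m : i \in S -> gamma_on S m.+1 -> gamma_on (S :\ i) m.
Proof.
move=> iS gS; elim=> [|j IH] jm; first by rewrite elsym0.
have a0 := IH (ltnW jm); rewrite ltNge; apply/negP => b0.
have := gS j.+1 (leqW jm); have := gS j.+2 jm.
rewrite !(elsym_del _ _ iS); have := elsym_newton (S :\ i) j.
set a := elsym _ _ j in a0 *; set b := elsym _ _ j.+1 in b0 *; set c := elsym _ _ j.+2.
move=> nw h2 h1.
have h3 : a * (x i * b) + a * c > 0 by rewrite -mulrDr mulr_gt0.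
have : 0 <= - b * (x i * a + b) by rewrite mulr_ge0 ?oppr_ge0 // ltW.
nra.
Qed.

End Newton.

(** * Quotients of consecutive symmetric polynomials along a line *)

(* [(a0, a1, a2)] stands for the value and the first two derivatives at 0 of a
   function of one real variable; [quo0], [quo1], [quo2] are those of a / b. *)
Section Jets.
Variable R : realFieldType.
Implicit Types (a b x p : R).

Definition quo0 a0 b0 := a0 / b0.
Definition quo1 a0 a1 b0 b1 := (a1 - quo0 a0 b0 * b1) / b0.
Definition quo2 a0 a1 a2 b0 b1 b2 :=
  (a2 - 2 * quo1 a0 a1 b0 b1 * b1 - quo0 a0 b0 * b2) / b0.

(* The jet of the harmonic sum x p / (x + p), when x is affine. *)
Definition har0 x p := x * p / (x + p).
Definition har1 x dx p p1 := (x / (x + p)) ^+ 2 * p1 + (p / (x + p)) ^+ 2 * dx.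
Definition har2 x dx p p1 p2 :=
  (x / (x + p)) ^+ 2 * p2
  - 2 / (x + p) * (p / (x + p) * dx - x / (x + p) * p1) ^+ 2.

Section QuoHar.
Variables (x dx u0 u1 u2 v0 v1 v2 : R).
Hypotheses (v0_gt0 : 0 < v0) (w0_gt0 : 0 < x * v0 + u0).
Let p0 := quo0 u0 v0.
Let p1 := quo1 u0 u1 v0 v1.
Let p2 := quo2 u0 u1 u2 v0 v1 v2.
Let w0 := x * v0 + u0.
Let w1 := dx * v0 + x * v1 + u1.
Let w2 := 2 * dx * v1 + x * v2 + u2.

Let v0N0 : v0 != 0. Proof. by rewrite gt_eqF. Qed.
Let w0N0 : x * v0 + u0 != 0. Proof. by rewrite gt_eqF. Qed.

(** With u, v the polynomials of order m + 1, m of S \ i, the polynomial of order m + 1 of S is x v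
    + u. Dividing x u / (x v + u) through by v gives the harmonic sum of x and u / v; the next two
    lemmas are its derivatives. *)
Lemma quo_har0 : quo0 (x * u0) w0 = har0 x p0.
Proof. by rewrite /har0 /p0 /w0 /quo0; field; apply/andP. Qed.

Lemma quo_har1 : quo1 (x * u0) (dx * u0 + x * u1) w0 w1 = har1 x dx p0 p1.
Proof. by rewrite /har1 /p0 /p1 /w0 /w1 /quo1 /quo0; field; apply/andP. Qed.

Lemma quo_har2 :
  quo2 (x * u0) (dx * u0 + x * u1) (2 * dx * u1 + x * u2) w0 w1 w2
  = har2 x dx p0 p1 p2.
Proof.
by rewrite /har2 /p0 /p1 /p2 /w0 /w1 /w2 /quo2 /quo1 /quo0; field; apply/andP.
Qed.
End QuoHar.

End Jets.

(** * Directional derivatives of symmetric polynomials and of their quotients *)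

Section SymmetricJets.
Variables (R : realFieldType) (I : finType) (lam xi : I -> R).
Implicit Types (S : {set I}) (i : I) (m : nat).

Definition line i : {poly R} := (lam i)%:P + xi i *: 'X.

Definition dsym S m : R := (elsym line S m)^`().[0].
Definition ddsym S m : R := (elsym line S m)^`()^`().[0].

Let line0 i : (line i).[0] = lam i.
Proof. by rewrite /line !hornerE ?mulr0 ?addr0. Qed.

Let line1 i : (line i)^`() = (xi i)%:P.
Proof. by rewrite /line derivD derivC add0r derivZ derivX alg_polyC. Qed.

Lemma elsym_line0 S m : (elsym line S m).[0] = elsym lam S m.
Proof.
rewrite -[LHS]/(horner_eval 0 _) elsym_morph.
by apply: eq_bigr => T _; apply: eq_bigr => i _; apply: line0.
Qed.

Lemma dsym0 S : dsym S 0 = 0.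
Proof. by rewrite /dsym elsym0 derivC horner0. Qed.

Lemma ddsym0 S : ddsym S 0 = 0.
Proof. by rewrite /ddsym elsym0 derivC deriv0 horner0. Qed.

Lemma dsymE S m : dsym S m.+1 = \sum_(i in S) xi i * elsym lam (S :\ i) m.
Proof.
rewrite /dsym deriv_elsym horner_sum; apply: eq_bigr => i _.
by rewrite hornerM line1 hornerC elsym_line0.
Qed.

Lemma ddsymE S m : ddsym S m.+1 = \sum_(i in S) xi i * dsym (S :\ i) m.
Proof.
rewrite /ddsym deriv_elsym raddf_sum horner_sum; apply: eq_bigr => i _ /=.
by rewrite derivM line1 derivC mul0r add0r hornerM hornerC.
Qed.

Lemma ddsym1 S : ddsym S 1 = 0.
Proof. by rewrite ddsymE big1 // => i _; rewrite dsym0 mulr0. Qed.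

Let deriv_lineM i (p : {poly R}) :
  (line i * p)^`().[0] = xi i * p.[0] + lam i * p^`().[0].
Proof. by rewrite derivM line1 hornerD !hornerM line0 hornerC. Qed.

Let deriv2_lineM i (p : {poly R}) :
  (line i * p)^`()^`().[0] = 2 * xi i * p^`().[0] + lam i * p^`()^`().[0].
Proof.
rewrite derivM line1 derivD derivM derivC mul0r add0r hornerD deriv_lineM.
by rewrite hornerM hornerC; ring.
Qed.

Lemma dsym_del S i m : i \in S ->
  dsym S m.+1 = xi i * elsym lam (S :\ i) m + lam i * dsym (S :\ i) m
                + dsym (S :\ i) m.+1.
Proof.
move=> iS; rewrite /dsym (elsym_del _ _ iS) derivD hornerD deriv_lineM.
by rewrite elsym_line0.
Qed.

Lemma ddsym_del S i m : i \in S ->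
  ddsym S m.+1 = 2 * xi i * dsym (S :\ i) m + lam i * ddsym (S :\ i) m
                 + ddsym (S :\ i) m.+1.
Proof.
move=> iS; rewrite /ddsym (elsym_del _ _ iS) derivD derivD hornerD.
by rewrite deriv2_lineM.
Qed.

Lemma dsym_add1 S m :
  \sum_(i in S) (xi i * elsym lam (S :\ i) m + lam i * dsym (S :\ i) m)
  = m.+1%:R * dsym S m.+1.
Proof.
have /(congr1 (fun p => p^`().[0])) := elsym_add1 line S m.
rewrite raddf_sum horner_sum mulr_natl derivMn hornerMn -mulr_natl.
rewrite -/(dsym _ _) => <-; apply: eq_bigr => i _ /=.
by rewrite deriv_lineM elsym_line0.
Qed.

Lemma ddsym_add1 S m :
  \sum_(i in S) (2 * xi i * dsym (S :\ i) m + lam i * ddsym (S :\ i) m)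
  = m.+1%:R * ddsym S m.+1.
Proof.
have /(congr1 (fun p => p^`()^`().[0])) := elsym_add1 line S m.
rewrite !raddf_sum horner_sum mulr_natl !derivMn hornerMn -mulr_natl.
rewrite -/(ddsym _ _) => <-; apply: eq_bigr => i _ /=.
by rewrite deriv2_lineM.
Qed.

Definition quot S m := quo0 (elsym lam S m.+1) (elsym lam S m).
Definition dquot S m :=
  quo1 (elsym lam S m.+1) (dsym S m.+1) (elsym lam S m) (dsym S m).
Definition ddquot S m :=
  quo2 (elsym lam S m.+1) (dsym S m.+1) (ddsym S m.+1)
       (elsym lam S m) (dsym S m) (ddsym S m).

Lemma quot0E S : quot S 0 = \sum_(i in S) lam i.
Proof.
have := elsym_add1 lam S 0; rewrite mul1r /quot /quo0 elsym0 divr1 => <-.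
by apply: eq_bigr => i _; rewrite elsym0 mulr1.
Qed.

Lemma ddquot0E S : ddquot S 0 = 0.
Proof. by rewrite /ddquot /quo2 ddsym1 ddsym0 dsym0 !mulr0 !subr0 mul0r. Qed.

Section Recursion.
Variables (S : {set I}) (m : nat).
Hypothesis gS : gamma_on lam S m.+1.

Lemma gamma_del_gt0 i : i \in S -> 0 < elsym lam (S :\ i) m.
Proof. by move=> iS; apply: (gamma_on_del iS gS). Qed.

Lemma denom_del i : i \in S ->
  lam i + quot (S :\ i) m = elsym lam S m.+1 / elsym lam (S :\ i) m.
Proof.
move=> iS; rewrite /quot /quo0 (elsym_del _ _ iS) mulrDl mulfK //.
by rewrite gt_eqF // gamma_del_gt0.
Qed.

Lemma denom_del_gt0 i : i \in S -> 0 < lam i + quot (S :\ i) m.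
Proof.
by move=> iS; rewrite denom_del // divr_gt0 ?gamma_del_gt0 //; apply: gS.
Qed.

Lemma quot_rec :
  m.+2%:R * quot S m.+1 = \sum_(i in S) har0 (lam i) (quot (S :\ i) m).
Proof.
rewrite {1}/quot /quo0 mulrA -elsym_add1 mulr_suml; apply: eq_bigr => i iS.
have v0 := gamma_del_gt0 iS; have w0 := gS (leqnn _).
by rewrite -quo_har0 // /quo0 -?(elsym_del _ _ iS).
Qed.

Lemma dquot_rec :
  m.+2%:R * dquot S m.+1 =
  \sum_(i in S) har1 (lam i) (xi i) (quot (S :\ i) m) (dquot (S :\ i) m).
Proof.
have -> : m.+2%:R * dquot S m.+1 =
   (m.+2%:R * dsym S m.+2 - m.+2%:R * elsym lam S m.+2 / elsym lam S m.+1
      * dsym S m.+1) / elsym lam S m.+1.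
  by rewrite /dquot /quo1 /quo0; ring.
rewrite -dsym_add1 -elsym_add1 !mulr_suml -sumrB mulr_suml.
apply: eq_bigr => i iS.
have v0 := gamma_del_gt0 iS; have w0 := gS (leqnn _).
rewrite -quo_har1 // -?(elsym_del _ _ iS) // -(dsym_del _ iS).
by rewrite /quo1 /quo0.
Qed.

Lemma ddquot_rec :
  m.+2%:R * ddquot S m.+1 =
  \sum_(i in S) har2 (lam i) (xi i)
     (quot (S :\ i) m) (dquot (S :\ i) m) (ddquot (S :\ i) m).
Proof.
have -> : m.+2%:R * ddquot S m.+1 =
   (m.+2%:R * ddsym S m.+2 - 2 * (m.+2%:R * dquot S m.+1) * dsym S m.+1
    - m.+2%:R * quot S m.+1 * ddsym S m.+1) / elsym lam S m.+1.
  by rewrite /ddquot /quo2 /dquot /quot; ring.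
rewrite quot_rec dquot_rec -ddsym_add1 mulr_sumr !mulr_suml -!sumrB mulr_suml.
apply: eq_bigr => i iS.
have v0 := gamma_del_gt0 iS; have w0 := gS (leqnn _).
rewrite -quo_har2 -?(elsym_del _ _ iS) // -(dsym_del _ iS) -(ddsym_del _ iS).
rewrite -quo_har1 -?quo_har0 -?(elsym_del _ _ iS) // -(dsym_del _ iS).
by [].
Qed.

End Recursion.

(** [har2] is a nonnegative multiple of p'' minus a square, so [ddquot_rec] carries concavity from
    the sets S \ i to S, starting from a linear function. *)
Lemma ddquot_le0 S m : gamma_on lam S m -> ddquot S m <= 0.
Proof.
elim: m S => [|m IH] S gS; first by rewrite ddquot0E.
rewrite -(pmulr_rle0 _ (ltr0Sn R m.+1)) ddquot_rec //; apply: sumr_le0 => i iS.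
have y0 := denom_del_gt0 gS iS; have := IH _ (gamma_on_del iS gS).
rewrite /har2 => p2; rewrite subr_le0.
apply: (@le_trans _ _ 0); first by rewrite mulr_ge0_le0 // sqr_ge0.
by rewrite mulr_ge0 ?sqr_ge0 // divr_ge0 // ltW.
Qed.

(* Equivalent to the concavity of [e_m^(1/m)] on the cone. *)
Lemma elsym_concave S m : gamma_on lam S m ->
  m%:R * (elsym lam S m * ddsym S m) <= (m%:R - 1) * dsym S m ^+ 2.
Proof.
case: m => [|m]; first by rewrite mul0r dsym0 expr0n mulr0.
elim: m => [|m IH] gS; first by rewrite ddsym1 !mulr0 subrr mul0r.
have := IH (gamma_onW (leqnSn _) gS).
have := ddquot_le0 (gamma_onW (leqnSn _) gS).
have a0 := gS m.+2 (leqnn _); have b0 := gS m.+1 (leqnSn _).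
have n0 : (0 : R) <= m%:R by [].
set a := elsym lam S m.+2 in a0 *; set b := elsym lam S m.+1 in b0 *.
rewrite /ddquot -/a -/b.
set q := quo0 a b; set p := quo1 a (dsym S m.+2) b (dsym S m.+1).
set r := quo2 _ _ _ _ _ _ => r0 hb.
have qE : a = q * b by rewrite /q /quo0 divfK // gt_eqF.
have q_gt0 : 0 < q by rewrite divr_gt0.
have pE : dsym S m.+2 = p * b + q * dsym S m.+1.
  by rewrite /p /quo1 divfK ?gt_eqF // subrK.
have rE : ddsym S m.+2 = r * b + 2 * p * dsym S m.+1 + q * ddsym S m.+1.
  rewrite /r /quo2 divfK ?gt_eqF // -/q -/p; ring.
rewrite qE pE rE; set b1 := dsym S m.+1 in hb *; set b2 := ddsym S m.+1 in hb *.
have M0 : 0 < m.+1%:R :> R by [].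
have h1 : m.+2%:R * (q * b * (r * b)) <= 0.
  apply: mulr_ge0_le0 => //; apply: mulr_ge0_le0; first by apply/ltW/mulr_gt0.
  by apply: mulr_le0_ge0 => //; apply: ltW.
(* After multiplication by m + 1, the right side minus the left side is this square up to the terms
   controlled by [h1] and [h3]. *)
have h2 : 0 <= (m.+1%:R * p * b - q * b1) ^+ 2 by apply: sqr_ge0.
have h3 : m.+2%:R * q ^+ 2 * (m.+1%:R * (b * b2))
          <= m.+2%:R * q ^+ 2 * ((m.+1%:R - 1) * b1 ^+ 2).
  by rewrite ler_wpM2l // mulr_ge0 // sqr_ge0.
rewrite -(ler_pM2l M0).
have M0' := ltW M0.
have h1' : m.+1%:R * (m.+2%:R * (q * b * (r * b))) <= 0 by rewrite mulr_ge0_le0.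
move: h1' h2 h3; rewrite -[m.+2%:R]natr1; set M := m.+1%:R; lra.
Qed.

End SymmetricJets.

(** * The gradient of the quotient when some coordinates are large *)

Section CauchySchwarz.
Variable R : realFieldType.
Implicit Types a b c d : R.

(** Only 2 s t <= a d + c b is at stake; it is compared after squaring, by (s t)^2 <= (a d)(c b),
    which avoids square roots. *)
Lemma cauchy_schwarz2 a b s c d t :
  0 <= a -> 0 <= b -> 0 <= c -> 0 <= d -> s ^+ 2 <= a * b -> t ^+ 2 <= c * d ->
  (s + t) ^+ 2 <= (a + c) * (b + d).
Proof.
move=> a0 b0 c0 d0 hs ht.
have ad0 : 0 <= a * d by apply: mulr_ge0.
have cb0 : 0 <= c * b by apply: mulr_ge0.
have : s ^+ 2 * t ^+ 2 <= a * b * (c * d) by apply: ler_pM => //; apply: sqr_ge0.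
have : 2 * (s * t) <= a * d + c * b; last by lra.
have [le0|gt0] := lerP (s * t) 0; first by nra.
have : (2 * (s * t)) ^+ 2 <= (a * d + c * b) ^+ 2.
  have : s ^+ 2 * t ^+ 2 <= a * b * (c * d) by apply: ler_pM => //; apply: sqr_ge0.
  have := sqr_ge0 (a * d - c * b); nra.
by rewrite ler_pXn2r ?nnegrE //; lra.
Qed.

Lemma cauchy_schwarz_sum (I : finType) (P : pred I) (s a b : I -> R) :
  (forall i, P i -> [/\ 0 <= a i, 0 <= b i & s i ^+ 2 <= a i * b i]) ->
  (\sum_(i | P i) s i) ^+ 2 <= (\sum_(i | P i) a i) * (\sum_(i | P i) b i).
Proof.
move=> h; pose K (x y z : R) := [/\ 0 <= y, 0 <= z & x ^+ 2 <= y * z].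
suff : K (\sum_(i | P i) s i) (\sum_(i | P i) a i) (\sum_(i | P i) b i) by case.
apply: (big_ind3 K) => //.
move=> x1 y1 z1 x2 y2 z2 [y10 z10 h1] [y20 z20 h2].
by split; rewrite ?addr_ge0 //; apply: cauchy_schwarz2.
Qed.

End CauchySchwarz.

Section Harmonic.
Variable R : realFieldType.
Implicit Types (x p b : R).

Lemma har0_lel x p : 0 < x + p -> har0 x p <= x.
Proof.
move=> y0; rewrite /har0 ler_pdivrMr //; have := sqr_ge0 x; nra.
Qed.

Lemma har0_ler x p : 0 < x + p -> har0 x p <= p.
Proof.
move=> y0; rewrite /har0 ler_pdivrMr //; have := sqr_ge0 p; nra.
Qed.

(** The derivative is (p / y) dx - (x / y) W with y = x + p: the first part is paid by the extra
    term in dx^2, the second by the square of W inside - [har2]. *)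
Lemma har_small x dx p p1 p2 b : 0 < x + p -> 0 < b -> p2 <= 0 ->
  let A := p / b + x / 2 - (2^-1 + b^-1) * har0 x p in
  0 <= A /\
  har1 x dx p p1 ^+ 2 <= A * (- har2 x dx p p1 p2 + b * (dx ^+ 2 / (x + p))).
Proof.
move=> y0 b0 p20; set y := x + p in y0 *.
have yN : y != 0 by rewrite gt_eqF.
have bN : b != 0 by rewrite gt_eqF.
have AE : p / b + x / 2 - (2^-1 + b^-1) * har0 x p
          = p ^+ 2 / (b * y) + x ^+ 2 / (2 * y).
  by move: yN; rewrite /har0 /y => yN; field; apply/andP.
rewrite AE /=.
have A1 : 0 <= p ^+ 2 / (b * y) by rewrite divr_ge0 ?sqr_ge0 // ltW // mulr_gt0.
have A2 : 0 <= x ^+ 2 / (2 * y) by rewrite divr_ge0 ?sqr_ge0 // ltW // mulr_gt0.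
split; first exact: addr_ge0.
set W := p / y * dx - x / y * p1.
have -> : har1 x dx p p1 = p / y * dx + (- (x / y * W)).
  by rewrite /har1 /W; move: yN; rewrite /y => yN; field.
have h2 : - har2 x dx p p1 p2 + b * (dx ^+ 2 / y)
   = b * (dx ^+ 2 / y) + 2 / y * W ^+ 2 + (x / y) ^+ 2 * - p2.
  by rewrite /har2 -/y -/W; ring.
have p2' : 0 <= (x / y) ^+ 2 * - p2 by rewrite mulr_ge0 ?sqr_ge0 // oppr_ge0.
have B1 : 0 <= b * (dx ^+ 2 / y).
  by rewrite mulr_ge0 ?divr_ge0 ?sqr_ge0 // ltW.
have B2 : 0 <= 2 / y * W ^+ 2.
  by rewrite mulr_ge0 ?sqr_ge0 // divr_ge0 // ltW.
apply: (@le_trans _ _ ((p ^+ 2 / (b * y) + x ^+ 2 / (2 * y))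
                       * (b * (dx ^+ 2 / y) + 2 / y * W ^+ 2))); last first.
  by rewrite h2 ler_wpM2l ?addr_ge0 // lerDl.
apply: cauchy_schwarz2 => //.
  by rewrite le_eqVlt; apply/orP; left; apply/eqP; field; apply/andP.
by rewrite le_eqVlt; apply/orP; left; apply/eqP; field.
Qed.

(** Without an extra term in dx^2 the derivative is written (x / y) p1 + (p / y) W: the assumed
    bound for p pays the first part, the square of W the second. *)
Lemma har_big x dx p p1 p2 th w : 0 < x + p -> 0 <= th -> 0 <= w -> p2 <= 0 ->
  p1 ^+ 2 <= th * (- p2 + w) ->
  0 <= th + p ^+ 2 / (2 * (x + p)) /\
  har1 x dx p p1 ^+ 2 <= (th + p ^+ 2 / (2 * (x + p)))
    * (- har2 x dx p p1 p2 + (x / (x + p)) ^+ 2 * w).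
Proof.
move=> y0 th0 w0 p20 hp; set y := x + p in y0 *.
have yN : y != 0 by rewrite gt_eqF.
have C0 : 0 <= p ^+ 2 / (2 * y) by rewrite divr_ge0 ?sqr_ge0 // ltW // mulr_gt0.
split; first exact: addr_ge0.
set W := p / y * dx - x / y * p1.
have -> : har1 x dx p p1 = x / y * p1 + p / y * W.
  by rewrite /har1 /W; move: yN; rewrite /y => yN; field.
have -> : - har2 x dx p p1 p2 + (x / y) ^+ 2 * w
   = (x / y) ^+ 2 * (- p2 + w) + 2 / y * W ^+ 2.
  by rewrite /har2 -/y -/W; ring.
apply: cauchy_schwarz2 => //.
- by rewrite mulr_ge0 ?sqr_ge0 // addr_ge0 // oppr_ge0.
- by rewrite mulr_ge0 ?sqr_ge0 // divr_ge0 // ltW.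
- by rewrite exprMn [X in _ <= X]mulrCA ler_wpM2l // sqr_ge0.
by rewrite le_eqVlt; apply/orP; left; apply/eqP; field.
Qed.

End Harmonic.

(** * Induction over the large coordinates *)

Section Pinching.
Variables (R : realFieldType) (I : finType) (lam xi : I -> R).
Variables (N : nat) (r M eps kap : R).
Implicit Types (S B : {set I}) (i j : I) (m : nat).
Local Notation q0 := (quot lam).
Local Notation q1 := (dquot lam xi).
Local Notation q2 := (ddquot lam xi).

Hypothesis r_ge0 : 0 <= r.

(** In [quot_rec] a harmonic sum is at most its small coordinate or, for i in B, at most the
    quotient of S \ i, where both the order and the number of large coordinates drop by one. *)
Lemma quot_le S B m : B \subset S -> (#|B| <= m)%N -> (#|S| <= N)%N ->
  gamma_on lam S m -> (forall i, i \in S :\: B -> lam i <= r) ->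
  q0 S m <= N%:R * r.
Proof.
elim: m S B => [|m IH] S B BS Bm SN gS small.
  have B0 : B = set0 by apply/eqP; rewrite -cards_eq0 -leqn0.
  rewrite quot0E; apply: (@le_trans _ _ (\sum_(i in S) r)).
    by apply: ler_sum => i iS; apply: small; rewrite B0 setD0.
  by rewrite sumr_const -[_ *+ #|S|]mulr_natl ler_wpM2r // ler_nat.
have m2 : 0 < m.+2%:R :> R by [].
rewrite -(ler_pM2l m2) quot_rec // (big_setID B) /= (setIidPr BS).
have h1 : \sum_(i in B) har0 (lam i) (q0 (S :\ i) m) <= m.+1%:R * (N%:R * r).
  apply: (@le_trans _ _ (\sum_(i in B) N%:R * r)).
    apply: ler_sum => i iB; have iS := subsetP BS _ iB.
    apply: le_trans (har0_ler (denom_del_gt0 gS iS)) _.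
    apply: (IH _ (B :\ i)); first exact: setSD.
    - by move: Bm; rewrite (cardsD1 i) iB.
    - by apply: leq_trans SN; apply/subset_leq_card/subsetDl.
    - exact: gamma_on_del.
    move=> t; rewrite !inE => /andP[tB /andP[ti tS]]; apply: small.
    by move: tB; rewrite inE ti tS andbT.
  rewrite sumr_const -[_ *+ #|B|]mulr_natl ler_wpM2r ?mulr_ge0 // ler_nat.
  exact: Bm.
have h2 : \sum_(i in S :\: B) har0 (lam i) (q0 (S :\ i) m) <= N%:R * r.
  apply: (@le_trans _ _ (\sum_(i in S :\: B) r)).
    apply: ler_sum => i iSB; have iS : i \in S by move: iSB; rewrite inE => /andP[].
    apply: le_trans (har0_lel (denom_del_gt0 gS iS)) _; exact: small.
  rewrite sumr_const -[_ *+ #|_|]mulr_natl ler_wpM2r // ler_nat.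
  by apply: leq_trans SN; apply/subset_leq_card/subsetDl.
apply: le_trans (lerD h1 h2) _; rewrite -[m.+2%:R]natr1; lra.
Qed.

Hypotheses (M_gt0 : 0 < M) (eps_gt0 : 0 < eps) (eps_le1 : eps <= 1).

(** The partial derivative of log e_(m+1)(S) in the i-th coordinate. *)
Definition wt S m i := elsym lam (S :\ i) m / elsym lam S m.+1.

Lemma wt_denom S m i : gamma_on lam S m.+1 -> i \in S ->
  wt S m i = (lam i + q0 (S :\ i) m)^-1.
Proof. by move=> gS iS; rewrite denom_del // invf_div. Qed.

(* The ratio x / (x + p) can only be large if p is close to -x, but then
   Newton's inequality forces the quotient of S to be very negative. *)
Lemma wt_le S m j : (#|S| <= N)%N -> gamma_on lam S m.+1 -> - M <= q0 S m.+1 ->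
  j \in S -> eps * M <= lam j <= M -> lam j * wt S m j <= 4 * N%:R / eps.
Proof.
move=> SN gS qM jS /andP[xl xu]; rewrite wt_denom //.
have y0 := denom_del_gt0 gS jS; have c0 := gamma_del_gt0 gS jS.
have N1 : 1 <= N%:R :> R.
  by rewrite ler1n; apply: leq_trans SN; apply/card_gt0P; exists j.
have x0 : 0 < lam j by apply: lt_le_trans xl; rewrite mulr_gt0.
have nw := elsym_newton lam (S :\ j) m.
have nws := elsym_newton_strict lam (S :\ j) m.
have SN' : (#|S :\ j|.+1)%:R <= N%:R :> R.
  by rewrite ler_nat; apply: leq_trans SN; rewrite [X in (_ <= X)%N](cardsD1 j) jS.
have sE : elsym lam S m.+1 = (lam j + q0 (S :\ j) m) * elsym lam (S :\ j) m.
  by rewrite denom_del // divfK // gt_eqF.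
have pE : elsym lam (S :\ j) m.+1 = q0 (S :\ j) m * elsym lam (S :\ j) m.
  by rewrite /quot /quo0 divfK // gt_eqF.
have {}qM : - M * elsym lam S m.+1 <= elsym lam S m.+2.
  by rewrite -ler_pdivlMr ?(gS m.+1).
rewrite (elsym_del _ m.+1 jS) sE in qM.
rewrite pE in nw nws qM *.
set x := lam j in x0 xl xu y0 qM *; set c := elsym lam (S :\ j) m in c0 nw nws qM *.
set p := q0 (S :\ j) m in y0 nw nws qM *; set w := elsym _ _ m.+2 in nw nws qM *.
have n1 : p ^+ 2 * c <= N%:R * (p ^+ 2 * c - w).
  rewrite -(ler_pM2r c0).
  have : (p * c) ^+ 2 <= N%:R * ((p * c) ^+ 2 - c * w).
    by apply: le_trans nws _; rewrite ler_wpM2r // subr_ge0.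
  lra.
have n2 : p ^+ 2 * c - w <= (M + p) * (x + p) * c by lra.
have n3 : p ^+ 2 <= N%:R * ((M + p) * (x + p)).
  rewrite -(ler_pM2r c0); apply: le_trans n1 _; rewrite -[X in _ <= X]mulrA ler_wpM2l //; lra.
rewrite -[X in X <= _]/(x / (x + p)) ler_pdivrMr // mulrAC ler_pdivlMr //.
(* In the second case p < - x / 2, so p^2 >= x^2 / 4 while M + p <= M, and [n3] bounds x + p below
   by eps x / (4 N). *)
have [big|small] := lerP (x / 2) (x + p).
  have : x * eps <= 4 * N%:R * (x / 2).
    have : 0 <= x * (1 - eps) by apply: mulr_ge0; [exact: ltW | by rewrite subr_ge0].
    have : 0 <= x * (N%:R - 1) by apply: mulr_ge0; [exact: ltW | by rewrite subr_ge0].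
    lra.
  move=> h; apply: le_trans h _; rewrite ler_wpM2l //; lra.
have : x ^+ 2 / 4 <= p ^+ 2 by nra.
have : N%:R * ((M + p) * (x + p)) <= N%:R * (M * (x + p)).
  rewrite ler_wpM2l // ler_wpM2r //; lra.
move=> h1 h2.
have h3 : x * (eps * M) <= x ^+ 2 by rewrite expr2 ler_wpM2l // ltW.
rewrite -(ler_pM2r M_gt0); lra.
Qed.

Hypothesis kap_ge1 : 1 <= kap.

(** Over the common denominator e_(m+2)(S) the claim is x_j c <= kap (x_j c + w), with c and w the
    polynomials of S without i and j. Positivity of e_(m+1)(S \ j) gives w > - x_i c >= - r c. *)
Lemma wt_del S m i j : gamma_on lam S m.+2 -> i \in S -> j \in S -> i != j ->
  lam i <= r -> lam j <= kap * (lam j - r) -> 0 < lam j ->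
  (lam j * wt S m.+1 j) * wt (S :\ j) m i <= kap * wt S m.+1 i.
Proof.
move=> gS iS jS ij lir hk x0; rewrite /wt.
have g1 := gamma_on_del iS gS; have g2 := gamma_on_del jS gS.
have ij' : i \in S :\ j by rewrite !inE ij.
have ji' : j \in S :\ i by rewrite !inE eq_sym ij.
have g3 := gamma_on_del ij' g2.
have a0 := g2 _ (leqnn _); have b0 := gS _ (leqnn _); have c0 := g3 _ (leqnn _).
have d0 := g1 _ (leqnn _).
have -> : lam j * (elsym lam (S :\ j) m.+1 / elsym lam S m.+2) *
   (elsym lam (S :\ j :\ i) m / elsym lam (S :\ j) m.+1) =
   lam j * elsym lam (S :\ j :\ i) m / elsym lam S m.+2.
  by field; rewrite !gt_eqF.
rewrite mulrA ler_wpM2r ?invr_ge0 ?(ltW b0) //.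
move: a0; rewrite (elsym_del _ m ij') (elsym_del _ m ji') [S :\ i :\ j]setD1C.
set c := elsym lam (S :\ j :\ i) m in c0 *; set w := elsym _ _ m.+1 => a0.
have : lam j * c <= kap * ((lam j - r) * c).
  by rewrite mulrA ler_wpM2r // ltW.
have : kap * ((lam j - r) * c) <= kap * (lam j * c + w).
  rewrite ler_wpM2l // ?(le_trans ler01) //.
  by have := ler_wpM2r (ltW c0) lir; lra.
lra.
Qed.

(** Each large coordinate costs a factor N for the sum over S and a factor 4 N / eps, the bound of
    [wt_le] for the ratio that divides nu. *)
Definition err (b : nat) (nu : R) :=
  N%:R ^+ b.+1 * (N%:R * (4 * N%:R / eps) ^+ b / nu + 1) * r.

(* The form of the constant [2^-1 + (mu nu)^-1] is what makes the induction
   close: peeling off a large coordinate turns nu into nu / alpha, where alpha is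
   the ratio x / (x + p), and the harmonic sum of x with a function satisfying
   the bound for nu / alpha satisfies the bound for nu exactly. *)
Lemma pinching m S B mu nu :
  (#|S| <= N)%N -> B \subset S -> (#|B| + mu = m.+2)%N -> (1 < mu)%N ->
  gamma_on lam S m.+1 -> - M <= q0 S m.+1 ->
  (forall i, i \in S :\: B -> lam i <= r) ->
  (forall j, j \in B -> (eps * M <= lam j <= M) && (lam j <= kap * (lam j - r))) ->
  0 < nu ->
  let A := err #|B| nu - (2^-1 + (mu%:R * nu)^-1) * q0 S m.+1 in
  0 <= A /\
  q1 S m.+1 ^+ 2 <= A * (- q2 S m.+1
    + nu * kap ^+ #|B| * \sum_(i in S :\: B) xi i ^+ 2 * wt S m i).
Proof.
elim/ltn_ind: m S B nu => m IH S B nu SN BS Bmu mu1 gS qM small big nu0 A.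
set b := #|B| in Bmu A *; set c := 2^-1 + (mu%:R * nu)^-1 in A *.
set K := kap ^+ b; set Sg := \sum_(i in S :\: B) _.
(* The share of one summand: [err b nu] is N times E', and there are at most N summands. *)
pose E' := N%:R ^+ b * (N%:R * (4 * N%:R / eps) ^+ b / nu + 1) * r.
have mu_gt0 : 0 < mu%:R :> R by rewrite ltr0n (ltn_trans _ mu1).
have mu0' := ltW mu_gt0; have nu0' := ltW nu0.
have k0 : 0 < kap by apply: lt_le_trans kap_ge1.
have K1 : 1 <= K by apply: exprn_ege1.
have K0 : 0 <= K by apply: le_trans K1.
have bm : (b <= m)%N by rewrite -2!ltnS -Bmu -addn2 leq_add2l.
have S0 : (0 < #|S|)%N.
  rewrite lt0n; apply/eqP => /eqP; rewrite cards_eq0 => /eqP S0.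
  by have := gS m.+1 (leqnn _); rewrite elsym_small ?ltxx // S0 cards0.
have N1 : 1 <= N%:R :> R by rewrite ler1n (leq_trans S0).
have N0 : 0 <= N%:R :> R by [].
have ab1 : 1 <= 4 * N%:R / eps by rewrite ler_pdivlMr // mul1r; have := eps_le1; lra.
have E'0 : 0 <= E'.
  rewrite !mulr_ge0 ?exprn_ge0 ?addr_ge0 ?divr_ge0 ?mulr_ge0 ?exprn_ge0 //.
  by rewrite (le_trans _ ab1).
have wt0 i : i \in S -> 0 <= wt S m i.
  by move=> iS; rewrite wt_denom // invr_ge0 ltW // denom_del_gt0.
have Sg0 : 0 <= Sg.
  apply: sumr_ge0 => i; rewrite inE => /andP[_ iS].
  by rewrite mulr_ge0 ?sqr_ge0 ?wt0.
pose p_ i := q0 (S :\ i) m.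
pose h0 i := har0 (lam i) (p_ i).
pose h1 i := har1 (lam i) (xi i) (p_ i) (q1 (S :\ i) m).
pose h2 i := har2 (lam i) (xi i) (p_ i) (q1 (S :\ i) m) (q2 (S :\ i) m).
(* A large coordinate may use all of [Sg], a small one mu times its own term. In total [Sg] is used
   |B| + mu = m + 2 times, the factor in [ddquot_rec]. *)
pose V i := - h2 i + (if i \in B then nu * K * Sg
                      else mu%:R * nu * K * (xi i ^+ 2 * wt S m i)).
have h2_le0 i : i \in S -> h2 i <= 0.
  move=> iS; have y0 := denom_del_gt0 gS iS.
  have p2 := ddquot_le0 xi (gamma_on_del iS gS).
  rewrite /h2 /har2 subr_le0; apply: (@le_trans _ _ 0).
    by rewrite mulr_ge0_le0 // sqr_ge0.
  by rewrite mulr_ge0 ?sqr_ge0 // divr_ge0 // ltW.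
have V0 i : i \in S -> 0 <= V i.
  move=> iS; rewrite /V addr_ge0 ?oppr_ge0 ?h2_le0 //; case: ifP => _.
    exact: mulr_ge0 (mulr_ge0 nu0' K0) Sg0.
  exact: mulr_ge0 (mulr_ge0 (mulr_ge0 mu0' nu0') K0) (mulr_ge0 (sqr_ge0 _) (wt0 _ iS)).
have weaken i a v : i \in S -> 0 <= a -> a <= E' - c * h0 i ->
    - h2 i + v <= V i -> h1 i ^+ 2 <= a * (- h2 i + v) ->
    [/\ 0 <= E' - c * h0 i, 0 <= V i & h1 i ^+ 2 <= (E' - c * h0 i) * V i].
  move=> iS a0 aE vV hi; split; [exact: le_trans aE | exact: V0 | ].
  apply: le_trans hi _; apply: le_trans (ler_wpM2l a0 vV) _.
  by apply: ler_wpM2r => //; apply: V0.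
have key i : i \in S ->
    [/\ 0 <= E' - c * h0 i, 0 <= V i & h1 i ^+ 2 <= (E' - c * h0 i) * V i].
  move=> iS; have y0 := denom_del_gt0 gS iS.
  have p2 := ddquot_le0 xi (gamma_on_del iS gS).
  have [iB|iB] := boolP (i \in B); last first.
    have b0 : 0 < mu%:R * nu by apply: mulr_gt0.
    have iSB : i \in S :\: B by rewrite inE iB.
    have pN : p_ i <= N%:R * r.
      apply: (@quot_le _ B) => //.
      - by rewrite subsetD1 BS iB.
      - by apply: leq_trans SN; apply/subset_leq_card/subsetDl.
      - exact: gamma_on_del.
      move=> t; rewrite !inE => /andP[tB /andP[ti tS]]; apply: small.
      by rewrite inE tB.
    have [a0 hi] := har_small (xi i) (q1 (S :\ i) m) y0 b0 p2.
    apply: (weaken _ _ _ iS a0 _ _ hi).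
      rewrite lerD2r; apply: (@le_trans _ _ ((N%:R / nu + 1) * r)).
        have -> : (N%:R / nu + 1) * r = N%:R * r / nu + r by ring.
        have lr : lam i / 2 <= r by have := small _ iSB; have := r_ge0; lra.
        apply: lerD lr; apply: (@le_trans _ _ (N%:R * r / (mu%:R * nu))).
          by rewrite ler_pM2r ?invr_gt0.
        rewrite ler_wpM2l ?mulr_ge0 // lef_pV2 ?posrE //.
        by rewrite ler_peMl // ler1n ltnW.
      rewrite ler_wpM2r //; apply: (@le_trans _ _ (N%:R * (4 * N%:R / eps) ^+ b / nu + 1)).
        by rewrite lerD2r ler_pM2r ?invr_gt0 // ler_peMr // exprn_ege1.
      rewrite ler_peMl ?exprn_ege1 // addr_ge0 // divr_ge0 ?mulr_ge0 ?exprn_ge0 //.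
      by rewrite (le_trans _ ab1).
    rewrite /V (negbTE iB) lerD2l wt_denom //.
    rewrite -[X in _ <= X]mulrA ler_wpM2l ?(ltW b0) // ler_peMl //.
    by rewrite divr_ge0 ?sqr_ge0 ?ltW.
  have /andP[/andP[xl xu] xk] := big _ iB.
  have x0 : 0 < lam i by apply: lt_le_trans xl; rewrite mulr_gt0.
  have b1 : b = (#|B :\ i|).+1 by rewrite /b (cardsD1 i) iB.
  have mE : m = m.-1.+1 by move: bm; rewrite b1; case: (m).
  pose al := lam i * wt S m i.
  have alE : al = lam i / (lam i + p_ i) by rewrite /al wt_denom.
  have al0 : 0 < al by rewrite alE divr_gt0.
  have al_le : al <= 4 * N%:R / eps by apply: wt_le => //; rewrite xl.
  have mlt : (m.-1 < m)%N by rewrite [X in (_ < X)%N]mE.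
  have := IH m.-1 mlt (S :\ i) (B :\ i) (nu / al); rewrite -mE => IHi.
  have SN' : (#|S :\ i| <= N)%N.
    by apply: leq_trans SN; apply/subset_leq_card/subsetDl.
  have Bmu' : (#|B :\ i| + mu)%N = m.+1.
    by move: Bmu; rewrite b1 addSn => -[].
  have qM' : - M <= q0 (S :\ i) m by move: xu; lra.
  have small' t : t \in S :\ i :\: (B :\ i) -> lam t <= r.
    rewrite !inE => /andP[tB /andP[ti tS]]; apply: small.
    by move: tB; rewrite inE ti tS andbT.
  have big' j : j \in B :\ i ->
      (eps * M <= lam j <= M) && (lam j <= kap * (lam j - r)).
    by rewrite inE => /andP[_ jB]; apply: big.
  have [th0 hth] := IHi SN' (setSD _ BS) Bmu' mu1 (gamma_on_del iS gS) qM' small'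
                        big' (divr_gt0 nu0 al0).
  set th := (X in 0 <= X) in th0 hth.
  set w := (X in _ <= th * (_ + X)) in hth.
  have SBE : S :\ i :\: (B :\ i) = S :\: B.
    apply/setP => t; rewrite !inE; case: (eqVneq t i) => [->|] //=.
    by rewrite iB.
  have w0 : 0 <= w.
    rewrite /w; apply: mulr_ge0.
      by apply: mulr_ge0; [apply/ltW/divr_gt0 | apply/exprn_ge0/ltW].
    apply: sumr_ge0 => t; rewrite SBE inE => /andP[tB tS]; rewrite mulr_ge0 ?sqr_ge0 //.
    have gi := gamma_on_del iS gS; rewrite {1}mE in gi.
    have ti : t \in S :\ i by rewrite !inE tS andbT; apply: contraNneq tB => ->.
    by rewrite wt_denom // invr_ge0 ltW // denom_del_gt0.
  have [a0 hi] := har_big (xi i) y0 th0 w0 p2 hth.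
  apply: (weaken _ _ _ iS a0 _ _ hi).
    (* With x = lam i and p = p_ i, p / 2 - p^2 / (2 (x + p)) is half the harmonic sum and al p is
       the harmonic sum, so the constant c is reproduced. *)
    have -> : th + q0 (S :\ i) m ^+ 2 / (2 * (lam i + q0 (S :\ i) m))
        = err #|B :\ i| (nu / al) - c * h0 i.
      rewrite /th /c /h0 /har0 alE /p_; field.
      by rewrite !gt_eqF.
    rewrite lerD2r /err /E' b1 ler_wpM2r // ler_wpM2l ?exprn_ge0 // lerD2r.
    rewrite exprS; set ab := 4 * N%:R / eps in ab1 al_le *.
    set Z := N%:R * ab ^+ #|B :\ i| / nu.
    have -> : N%:R * ab ^+ #|B :\ i| / (nu / al) = Z * al.
      by rewrite /Z; field; rewrite !gt_eqF.
    have -> : N%:R * (ab * ab ^+ #|B :\ i|) / nu = Z * ab by rewrite /Z; ring.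
    rewrite ler_wpM2l // /Z divr_ge0 ?mulr_ge0 ?exprn_ge0 //.
    by rewrite (le_trans _ ab1).
  rewrite /V iB lerD2l -alE /w SBE.
  (* One factor al cancels against nu / al; the other is absorbed into the weights by [wt_del], at
     the price of one factor kap. *)
  have -> : al ^+ 2 * (nu / al * kap ^+ #|B :\ i|
       * \sum_(t in S :\: B) xi t ^+ 2 * wt (S :\ i) m.-1 t)
     = nu * kap ^+ #|B :\ i|
       * \sum_(t in S :\: B) xi t ^+ 2 * (al * wt (S :\ i) m.-1 t).
    under [in RHS]eq_bigr do rewrite mulrCA.
    rewrite -mulr_sumr; field; exact: lt0r_neq0.
  have -> : nu * K * Sg
     = nu * kap ^+ #|B :\ i| * \sum_(t in S :\: B) xi t ^+ 2 * (kap * wt S m t).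
    under [in RHS]eq_bigr do rewrite mulrCA.
    by rewrite -mulr_sumr /K b1 exprSr /Sg; ring.
  apply: ler_wpM2l; first by rewrite mulr_ge0 ?exprn_ge0 ?ltW.
  apply: ler_sum => t tSB; apply: ler_wpM2l; first exact: sqr_ge0.
  have := tSB; rewrite inE => /andP[tB tS].
  rewrite /al mE; apply: wt_del => //; first by rewrite -mE.
  - by apply: contraNneq tB => ->.
  - exact: small.
have m2 : 0 < m.+2%:R :> R by [].
have cs := cauchy_schwarz_sum key.
have eA : \sum_(i in S) (E' - c * h0 i) = #|S|%:R * E' - m.+2%:R * (c * q0 S m.+1).
  rewrite sumrB sumr_const -mulr_sumr mulr_natl; congr (_ - _).
  by rewrite mulrCA quot_rec.
have eV : \sum_(i in S) V i = m.+2%:R * (- q2 S m.+1 + nu * K * Sg).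
  rewrite big_split /= sumrN mulrDr mulrN ddquot_rec //; congr (_ + _).
  rewrite (big_setID B) /= (setIidPr BS).
  rewrite (eq_bigr (fun=> nu * K * Sg)); last by move=> i ->.
  rewrite sumr_const.
  rewrite (eq_bigr (fun i => mu%:R * nu * K * (xi i ^+ 2 * wt S m i))); last first.
    by move=> i; rewrite inE => /andP[/negbTE -> _].
  rewrite -mulr_sumr -/Sg -Bmu natrD -/b -[_ *+ b]mulr_natl; ring.
have A_ge : \sum_(i in S) (E' - c * h0 i) <= m.+2%:R * A.
  rewrite eA /A mulrBr lerD2r.
  have -> : err b nu = N%:R * E' by rewrite /err /E' exprS; ring.
  apply: (@le_trans _ _ (N%:R * E')); first by rewrite ler_wpM2r // ler_nat.
  by apply: ler_peMl; [exact: mulr_ge0 | rewrite ler1n].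
have As0 : 0 <= \sum_(i in S) (E' - c * h0 i).
  by apply: sumr_ge0 => i /key[].
have Vs0 : 0 <= \sum_(i in S) V i by apply: sumr_ge0 => i /key[].
split; first by rewrite -(pmulr_rge0 _ m2); apply: le_trans A_ge.
have : (m.+2%:R * q1 S m.+1) ^+ 2
    <= m.+2%:R * A * (m.+2%:R * (- q2 S m.+1 + nu * K * Sg)).
  rewrite dquot_rec //; apply: le_trans cs _.
  by rewrite -eV ler_wpM2r.
have -> : m.+2%:R * A * (m.+2%:R * (- q2 S m.+1 + nu * K * Sg))
   = m.+2%:R ^+ 2 * (A * (- q2 S m.+1 + nu * K * Sg)) by ring.
by rewrite exprMn ler_pM2l // exprn_gt0.
Qed.
End Pinching.

(** * The quadratic form of the theorem *)

Section Concavity.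
Variables (R : realFieldType) (I : finType) (lam xi : I -> R) (o : I) (m : nat).
Let S := [set~ o].
Let g := elsym lam S m.+1.
Let q := quot lam S m.+1.
Let d := dquot lam xi S m.+1.
Let P := lam o + q.
Hypothesis gT : gamma_on lam setT m.+2.

Let gS : gamma_on lam S m.+1.
Proof. by rewrite /S -setTD; apply: gamma_on_del. Qed.

Let g_gt0 : 0 < g. Proof. exact: gS. Qed.

Let gN0 : g != 0. Proof. by rewrite gt_eqF. Qed.

Lemma elsym_peel : elsym lam setT m.+2 = g * P.
Proof.
rewrite (elsym_del _ _ (in_setT o)) setTD -/S /P /q /quot /quo0 -/g.
by field.
Qed.

Lemma peel_gt0 : 0 < P.
Proof. by rewrite -(pmulr_rgt0 _ g_gt0) -elsym_peel; apply: gT. Qed.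

Lemma dsym_peel :
  dsym lam xi setT m.+2 = g * (xi o + d) + P * dsym lam xi S m.+1.
Proof.
rewrite (dsym_del _ _ _ (in_setT o)) setTD -/S /P /d /q /dquot /quo1 /quot /quo0 -/g.
by field.
Qed.

Lemma ddsym_peel : ddsym lam xi setT m.+2 =
  g * ddquot lam xi S m.+1 + 2 * (xi o + d) * dsym lam xi S m.+1
  + P * ddsym lam xi S m.+1.
Proof.
rewrite (ddsym_del _ _ _ (in_setT o)) setTD -/S /P /d /q /ddquot /quo2 /dquot /quo1.
by rewrite /quot /quo0 -/g; field.
Qed.

(** With v = (xi_o + d) / P and w = g' / g, concavity of g^(1/(m+1)) reduces the right side to 2 v^2
    + 2 v w + (m+2)/(m+1) w^2 - q'' / P. Minimising over w leaves (m+3)/(m+2) v^2. *)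
Lemma log_concave_peel :
  ((m.+3)%:R / (m.+2)%:R * ((xi o + d) ^+ 2 / P) - ddquot lam xi S m.+1) / P
  <= - (ddsym lam xi setT m.+2 / elsym lam setT m.+2)
     + 2 * (dsym lam xi setT m.+2 ^+ 2 / elsym lam setT m.+2 ^+ 2).
Proof.
have P0 := peel_gt0; have PN : P != 0 by rewrite gt_eqF.
rewrite elsym_peel dsym_peel ddsym_peel.
have := elsym_concave xi gS; rewrite -/g.
set g1 := dsym _ _ S _; set g2 := ddsym _ _ S _; set p2 := ddquot _ _ _ _.
set y := xi o + d => hg.
have m0 : (0 : R) <= m%:R by [].
have M1 : 0 < m%:R + 1 :> R by lra.
have M2 : 0 < m%:R + 2 :> R by lra.
rewrite -subr_ge0.
set X := (X in 0 <= X).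
have -> : X = ((m%:R * g1 ^+ 2 - (m%:R + 1) * (g * g2)) / ((m%:R + 1) * g ^+ 2)
  + ((m%:R + 2) * (g1 / g) + (m%:R + 1) * (y / P)) ^+ 2
    / ((m%:R + 1) * (m%:R + 2))).
  rewrite /X -[m.+3%:R]natr1 -[m.+2%:R]natr1 -[m.+1%:R]natr1.
  by field; rewrite gN0 PN !gt_eqF //; lra.
apply: addr_ge0; apply: divr_ge0.
- by move: hg; rewrite -[m.+1%:R]natr1; lra.
- by rewrite mulr_ge0 ?sqr_ge0 // ltW.
- exact: sqr_ge0.
- by rewrite mulr_ge0 // ltW.
Qed.

Section Final.
Variables (N : nat) (r eps kap A : R) (B : {set I}) (mu : nat).
Hypotheses (SN : (#|S| <= N)%N) (BS : B \subset S) (Bmu : (#|B| + mu = m.+2)%N).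
Hypotheses (mu1 : (1 < mu)%N) (r_ge0 : 0 <= r) (o_gt0 : 0 < lam o).
Hypotheses (eps_gt0 : 0 < eps) (eps_le1 : eps <= 1) (kap_ge1 : 1 <= kap).
Hypothesis small : forall i, i \in S :\: B -> lam i <= r.
Hypothesis big : forall j, j \in B ->
  (eps * lam o <= lam j <= lam o) && (lam j <= kap * (lam j - r)).
Hypothesis A_gt0 : 0 < A.
Hypothesis kapA :
  3 / 2 * kap ^+ #|B| * (lam o + A + 1) <= 2 * (lam o - r).
Let D : R := (2 * (m + 8))%:R.
Hypothesis errD : (err N r eps #|B| (3 / 2) + N%:R * r) * D <= lam o.

Lemma concavity_estimate :
  (1 + (D - 1)^-1) * (g * xi o ^+ 2 / (lam o * elsym lam setT m.+2))
  <= - (ddsym lam xi setT m.+2 / elsym lam setT m.+2)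
     + 2 * (dsym lam xi setT m.+2 ^+ 2 / elsym lam setT m.+2 ^+ 2)
     + 2 * \sum_(i in S) elsym lam [set~ i] m.+1 * xi i ^+ 2
             / ((lam o + A + 1) * elsym lam setT m.+2).
Proof.
have P0 := peel_gt0; have PN : P != 0 by rewrite gt_eqF.
have m0 : (0 : R) <= m%:R by [].
have q_lo : - lam o <= q by move: P0; rewrite /P; lra.
have bm : (#|B| <= m)%N by rewrite -2!ltnS -Bmu -addn2 leq_add2l.
have q_hi : q <= N%:R * r by apply: (@quot_le _ _ _ N r r_ge0 _ B) => //; exact: leqW.
(* For nu = 3/2 and mu >= 2 the constant c is at most 5/6, while nu stays below the coefficient 2 of
   the sum over i > 1, as [kapA] requires. *)
have nu0 : 0 < 3 / 2 :> R by lra.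
have [rho0 hd] := pinching xi r_ge0 o_gt0 eps_gt0 eps_le1 kap_ge1 SN BS Bmu mu1
  gS q_lo small big nu0.
have errD' := errD.
set E := err _ _ _ _ _ in rho0 hd errD'; set c := 2^-1 + _ in rho0 hd.
rewrite -/q -/d in rho0 hd; set F0 := _ * _ * _ in hd; set p2 := ddquot _ _ _ _ in hd.
set rho := E - c * q in rho0 hd.
have c_lo : 2^-1 <= c by rewrite lerDl invr_ge0 mulr_ge0 // ltW.
have c_hi : c <= 5 / 6.
  have : (mu%:R * (3 / 2))^-1 <= 3^-1 :> R.
    rewrite lef_pV2 ?posrE //; last by rewrite mulr_gt0 // ltr0n (ltn_trans _ mu1).
    have : 2 <= mu%:R :> R by rewrite ler_nat.
    by lra.
  rewrite /c; lra.
have wt0 i : i \in S -> 0 <= wt lam S m i.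
  by move=> iS; rewrite wt_denom // invr_ge0 ltW // denom_del_gt0.
have F00 : 0 <= F0.
  apply: mulr_ge0.
    by apply: mulr_ge0; [lra | apply: exprn_ge0; apply: le_trans kap_ge1].
  apply: sumr_ge0 => i; rewrite inE => /andP[_ iS].
  by rewrite mulr_ge0 ?sqr_ge0 ?wt0.
have p20 : p2 <= 0 by apply: ddquot_le0.
have DE : D = 2 * (m%:R + 8) by rewrite /D natrM natrD.
have D0 : 0 < D by rewrite DE; lra.
have D10 : 0 < D - 1 by rewrite DE; lra.
pose t : R := (m%:R + 2) / (m%:R + 3).
have m3 : 0 < m%:R + 3 :> R by lra.
have m2 : 0 < m%:R + 2 :> R by lra.
have t0 : 0 < t by apply: divr_gt0.
(* D is chosen so that both t, the reciprocal of the factor in [log_concave_peel], and c are at most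
   1 - 2 / D. *)
have t1 : t <= 1 - 2 / D.
  rewrite DE /t -subr_ge0.
  have -> : 1 - 2 / (2 * (m%:R + 8)) - (m%:R + 2) / (m%:R + 3)
     = 5 / ((m%:R + 3) * (m%:R + 8)) :> R.
    by field; rewrite !gt_eqF //; lra.
  by rewrite divr_ge0 // mulr_ge0 //; lra.
have c1 : c <= 1 - 2 / D.
  apply: le_trans c_hi _; rewrite DE -subr_ge0.
  have -> : 1 - 2 / (2 * (m%:R + 8)) - 5 / 6 = (m%:R + 2) / (6 * (m%:R + 8)) :> R.
    by field; rewrite !gt_eqF //; lra.
  by rewrite divr_ge0 ?mulr_ge0 //; lra.
have NrE : E + N%:R * r <= lam o / D by rewrite ler_pdivlMr.
have Nr0 : 0 <= N%:R * r by apply: mulr_ge0.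
have t_lt1 : t <= 1 by apply: le_trans t1 _; rewrite gerBl divr_ge0 // ltW.
(* The term q (t - c) is bounded by q <= N r if c <= t, and by q >= - lam o otherwise. One of the
   two units of 1 / D pays for the errors. *)
have tot : P * t + rho <= lam o * (1 - D^-1).
  have -> : P * t + rho = lam o * t + q * (t - c) + E by rewrite /P /rho; ring.
  have [tc|ct] := lerP c t.
    have : q * (t - c) <= N%:R * r * (t - c) by rewrite ler_wpM2r // subr_ge0.
    have : N%:R * r * (t - c) <= N%:R * r * 1 by rewrite ler_wpM2l //; lra.
    have := ler_wpM2l (ltW o_gt0) t1; lra.
  have : - lam o * (c - t) <= q * (c - t) by rewrite ler_wpM2r // subr_ge0 ltW.
  have := ler_wpM2l (ltW o_gt0) c1; lra.
set y := xi o + d.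
have cs : xi o ^+ 2 <= (P * t + rho) * (t^-1 * (y ^+ 2 / P) + (- p2 + F0)).
  have -> : xi o = y + - d by rewrite /y; ring.
  apply: cauchy_schwarz2.
  - by rewrite mulr_ge0 // ltW.
  - by rewrite mulr_ge0 ?invr_ge0 ?divr_ge0 ?sqr_ge0 // ltW.
  - exact: rho0.
  - by rewrite addr_ge0 // oppr_ge0.
  - rewrite le_eqVlt; apply/orP; left; apply/eqP; field.
    by rewrite PN gt_eqF.
  - by rewrite sqrrN.
set F := t^-1 * _ + _ in cs.
have F_ge0 : 0 <= F.
  rewrite /F addr_ge0 ?addr_ge0 ?oppr_ge0 //.
  by rewrite mulr_ge0 ?invr_ge0 ?divr_ge0 ?sqr_ge0 // ltW.
(* The remaining factor 1 - 1 / D yields delta_0, since its inverse is 1 + 1 / (D - 1). *)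
have main : (1 + (D - 1)^-1) * (xi o ^+ 2 / lam o) <= F.
  have h : xi o ^+ 2 <= lam o * (1 - D^-1) * F.
    by apply: le_trans cs _; rewrite ler_wpM2r.
  have -> : (1 + (D - 1)^-1) * (xi o ^+ 2 / lam o)
      = xi o ^+ 2 / (lam o * (1 - D^-1)).
    by field; rewrite !gt_eqF //; lra.
  rewrite ler_pdivrMr; first by rewrite mulrC.
  rewrite mulr_gt0 // subr_gt0 invf_lt1 //; move: D10; lra.
have lA : 0 < lam o + A + 1 by have := o_gt0; have := A_gt0; lra.
have sii i : i \in S ->
    elsym lam [set~ i] m.+1 = (lam o - lam i) * elsym lam (S :\ i) m + g.
  move=> iS; have oi : o \in [set~ i].
    by move: iS; rewrite /S !inE eq_sym.
  rewrite (elsym_del _ _ oi) /g (elsym_del _ _ iS).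
  have -> : [set~ i] :\ o = S :\ i by rewrite /S -!setTD setD1C.
  by ring.
(* The terms of B are dropped. For small i, [sii] bounds the coefficient below by (lam o - r) e_m(S
   \ i), and [kapA] compares it with F0. *)
have sum_ge : F0 / P <= 2 * \sum_(i in S) elsym lam [set~ i] m.+1 * xi i ^+ 2
             / ((lam o + A + 1) * elsym lam setT m.+2).
  rewrite (big_setID B) /= (setIidPr BS).
  have hB : 0 <= \sum_(i in B) elsym lam [set~ i] m.+1 * xi i ^+ 2
             / ((lam o + A + 1) * elsym lam setT m.+2).
    apply: sumr_ge0 => i iB; have iS := subsetP BS _ iB.
    apply: divr_ge0; apply: mulr_ge0; rewrite ?sqr_ge0 ?(ltW lA) //.
      by rewrite -setTD; apply/ltW/(gamma_on_del (in_setT i) gT).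
    by apply/ltW/gT.
  rewrite mulrDr; apply: (@le_trans _ _ (2 * \sum_(i in S :\: B)
     elsym lam [set~ i] m.+1 * xi i ^+ 2
             / ((lam o + A + 1) * elsym lam setT m.+2))); last first.
    by rewrite lerDr mulr_ge0.
  rewrite /F0 mulrAC [X in X <= _]mulr_sumr [X in _ <= X]mulr_sumr; apply: ler_sum => i iSB.
  have iS : i \in S by move: iSB; rewrite inE => /andP[].
  have c0 := gamma_del_gt0 gS iS.
  rewrite elsym_peel (sii _ iS) /wt -/g.
  set K := kap ^+ #|B|; set L := lam o + A + 1; set e := elsym lam (S :\ i) m.
  have -> : 3 / 2 * K / P * (xi i ^+ 2 * (e / g))
     = (3 / 2 * K * L * e) * (xi i ^+ 2 / (L * g * P)).
    by field; rewrite PN gN0 gt_eqF.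
  have -> : 2 * (((lam o - lam i) * e + g) * xi i ^+ 2 / (L * (g * P)))
     = (2 * ((lam o - lam i) * e + g)) * (xi i ^+ 2 / (L * g * P)).
    by field; rewrite PN gN0 gt_eqF.
  rewrite ler_wpM2r //.
    by rewrite divr_ge0 ?sqr_ge0 // ltW // !mulr_gt0.
  have := ler_wpM2r (ltW c0) kapA; rewrite -/K -/L -/e => h.
  have : lam i * e <= r * e by rewrite ler_wpM2r ?(ltW c0) // small.
  have := g_gt0; lra.
have lc := log_concave_peel.
apply: le_trans (lerD lc sum_ge).
have -> : (1 + (D - 1)^-1) * (g * xi o ^+ 2 / (lam o * elsym lam setT m.+2))
   = (1 + (D - 1)^-1) * (xi o ^+ 2 / lam o) / P.
  rewrite elsym_peel; field.
  by rewrite PN gN0 !gt_eqF //; lra.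
rewrite -mulrDl ler_wpM2r ?invr_ge0 ?(ltW P0) //.
apply: le_trans main _; rewrite /F -/p2 /t invf_div.
rewrite -[m.+3%:R]natr1 -[m.+2%:R]natr1 -[m.+1%:R]natr1 -/y.
have -> : (m%:R + 1 + 1 + 1) / (m%:R + 1 + 1) = (m%:R + 3) / (m%:R + 2) :> R.
  by field; rewrite !gt_eqF //; lra.
by rewrite addrA.
Qed.

End Final.
End Concavity.

(** * Choice of the constants *)

Section LargeSigma.
Variables (R : realFieldType) (I : finType) (x : I -> R) (A L : R).
Hypotheses (A_gt0 : 0 < A) (AL : A <= L).
Hypothesis x_lo : forall i, - A < x i.
Hypothesis x_hi : forall i, x i <= L.

(** A negative factor has absolute value at most A and all others at most L. *)
Lemma prod_lower (T : {set I}) m : #|T| = m.+1 ->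
  - (A * L ^+ m) <= \prod_(i in T) x i.
Proof.
move=> cT; have L0 : 0 <= L by apply: le_trans AL; apply: ltW.
have AL0 : 0 <= A * L ^+ m by rewrite mulr_ge0 ?exprn_ge0 // ltW.
have [/existsP[i /andP[iT xi0]]|] := boolP [exists i, (i \in T) && (x i < 0)].
  rewrite (bigD1 i) //=.
  under eq_bigl => j do rewrite andbC -in_setD1.
  have cTi : #|T :\ i| = m by move: cT; rewrite (cardsD1 i) iT => -[].
  have xL j : `|x j| <= L.
    by rewrite ler_norml x_hi andbT; apply: le_trans (ltW (x_lo j)); rewrite lerN2.
  have pL : `|\prod_(j in T :\ i) x j| <= L ^+ m.
    rewrite normr_prod -cTi -prodr_const.
    by apply: ler_prod => j _; rewrite normr_ge0 xL.
  have xA : `|x i| <= A.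
    by rewrite ltr0_norm // lerNl; apply/ltW/x_lo.
  rewrite lerNl; apply: le_trans (ler_norm _) _.
  by rewrite normrN normrM ler_pM.
rewrite negb_exists => /forallP h.
apply: (@le_trans _ _ 0); first by rewrite oppr_le0.
apply: prodr_ge0 => i iT; have := h i; rewrite iT /= -leNgt.
by [].
Qed.

(** The product over T0 is large; each of the at most 2^|I| other products is bounded by
    [prod_lower]. *)
Lemma elsym_lower (T0 : {set I}) (l : R) m : #|T0| = m.+1 -> 0 <= l ->
  (forall i, i \in T0 -> l <= x i) ->
  l ^+ m.+1 - 2 ^+ #|I| * (A * L ^+ m) <= elsym x setT m.+1.
Proof.
move=> cT0 l0 hl; rewrite /elsym.
have L0 : 0 <= L by apply: le_trans AL; apply: ltW.
have AL0 : 0 <= A * L ^+ m by rewrite mulr_ge0 ?exprn_ge0 // ltW.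
rewrite (bigD1 T0) ?subsetT ?cT0 ?eqxx //=; apply: lerD.
  by rewrite -cT0 -prodr_const; apply: ler_prod => i iT; rewrite l0 hl.
apply: (@le_trans _ _ (\sum_(T : {set I} | (T \subset setT)
    && (#|T| == m.+1) && (T != T0)) - (A * L ^+ m))).
  rewrite sumr_const mulNrn lerN2 -[_ *+ #|_|]mulr_natl ler_wpM2r //.
  rewrite -natrX ler_nat -cardsT -card_powerset powersetT cardsT.
  exact: max_card.
by apply: ler_sum => T /andP[/andP[_ /eqP cT] _]; apply: prod_lower.
Qed.
End LargeSigma.

(** * Thresholds separating small from large coordinates *)

Section Thresholds.
Variables (R : realFieldType) (m N : nat).
Implicit Types (b : nat) (e : R).

(** The left side of [errD] at r = 1. *)
Definition err_total b e : R :=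
  (2 * (m + 8))%:R *
  (N%:R ^+ b.+1 * (N%:R * (4 * N%:R / e) ^+ b / (3 / 2) + 1) + N%:R).

(** The reciprocal of a sum of nonnegative terms meets the smallness condition of each term at
    once. *)
Definition next_threshold b e : R :=
  (16 + 9 * m.+1%:R / e + err_total b e)^-1.

(** Bounds for the ratios to lambda_1, each tiny compared to the previous one; the value 1 belongs
    to lambda_1 itself. *)
Fixpoint threshold b : R :=
  if b is b'.+1 then next_threshold b' (threshold b') else 1.

Lemma err_total_ge0 b e : 0 < e -> 0 <= err_total b e.
Proof.
move=> e0; have ab0 : 0 <= 4 * N%:R / e by apply: divr_ge0; [apply: mulr_ge0 | apply: ltW].
apply: mulr_ge0 => //; apply: addr_ge0 => //.
apply: mulr_ge0; first exact: exprn_ge0.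
apply: addr_ge0 => //; apply: divr_ge0; last by lra.
by apply: mulr_ge0 => //; apply: exprn_ge0.
Qed.

Lemma next_threshold_props b e : 0 < e -> let eta := next_threshold b e in
  [/\ 0 < eta, 16 * eta <= 1, 9 * m.+1%:R * eta <= e & eta * err_total b e <= 1].
Proof.
move=> e0 eta; have z0 := err_total_ge0 b e0.
have n0 : 0 <= 9 * m.+1%:R / e :> R by apply: divr_ge0; [apply: mulr_ge0 | apply: ltW].
have s0 : 0 < 16 + 9 * m.+1%:R / e + err_total b e by lra.
have eta0 : 0 < eta by rewrite invr_gt0.
split => //.
- rewrite /eta /next_threshold ler_pdivrMr // mul1r; lra.
- rewrite /eta /next_threshold ler_pdivrMr // -ler_pdivrMl // mulrC.
  lra.
- rewrite mulrC /eta /next_threshold ler_pdivrMr // mul1r; lra.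
Qed.

Lemma threshold_gt0 b : 0 < threshold b.
Proof. by elim: b => [|b /(next_threshold_props b)[]] //=. Qed.

Lemma threshold_le1 b : threshold b <= 1.
Proof.
case: b => [|b] //=.
have [] := next_threshold_props b (threshold_gt0 b); lra.
Qed.

Lemma bernoulli u b : 0 <= u <= 1 -> 1 - b%:R * u <= (1 - u) ^+ b :> R.
Proof.
move=> /andP[u0 u1]; elim: b => [|b IH]; first by rewrite mul0r subr0 expr0.
rewrite exprS; have u1' : 0 <= 1 - u by rewrite subr_ge0.
apply: le_trans (ler_wpM2l u1' IH); rewrite -natr1.
have : 0 <= b%:R * u ^+ 2 by rewrite mulr_ge0 ?sqr_ge0.
lra.
Qed.

End Thresholds.

Section Indices.
Variable n : nat.

Lemma card_initial_segment k : (k <= n)%N -> #|[set i : 'I_n | (i < k)%N]| = k.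
Proof.
move=> kn; have -> : [set i : 'I_n | (i < k)%N] = [set widen_ord kn j | j : 'I_k].
  apply/setP => i; rewrite inE; apply/idP/imsetP => [ik|[j _ ->]]; last first.
    exact: (ltn_ord j).
  by exists (Ordinal ik) => //; apply: val_inj.
by rewrite card_imset ?card_ord // => i j /(congr1 val) /= /val_inj.
Qed.

End Indices.

(** * The sums of the theorem as directional derivatives *)

Section Assembly.
Variables (R : realType) (n m : nat) (lam xi : 'I_n.+1 -> R).

Lemma sum_dsigma :
  \sum_i dsigma m.+1 i lam * xi i = dsym lam xi setT m.+1.
Proof.
rewrite dsymE; apply: eq_big => [i|i _]; first by rewrite inE.
by rewrite dsigma_elsym setTD mulrC.
Qed.

Lemma sum_ddsigma c :
  \sum_p \sum_(q | p != q) ddsigma m.+2 p q lam * xi p * xi q / c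
  = ddsym lam xi setT m.+2 / c.
Proof.
rewrite ddsymE mulr_suml; apply: eq_big => [p|p _]; first by rewrite inE.
rewrite dsymE mulr_sumr mulr_suml; apply: eq_big => [q|q pq].
  by rewrite !inE eq_sym andbT.
by rewrite ddsigma_elsym // setTD; congr (_ / _); ring.
Qed.

End Assembly.

Section Bounds.
Variables (R : realFieldType) (n m : nat) (A s : R) (lam : 'I_n.+1 -> R).
Hypotheses (mn : (m.+1 < n.+1)%N) (A_gt0 : 0 < A) (s_gt0 : 0 < s).
Hypothesis sorted : forall i j : 'I_n.+1, (i <= j)%N -> lam j <= lam i.
Hypothesis lam_lo : - A < lam ord_max.
Hypothesis sig : elsym lam setT m.+2 = s.
Let L := lam ord0.

Lemma le_lam0 i : lam i <= L.
Proof. exact: sorted. Qed.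

Lemma lam_gtN i : - A < lam i.
Proof. by apply: lt_le_trans lam_lo (sorted _); rewrite -ltnS. Qed.

(** Otherwise the first m + 2 coordinates all exceed eta L, and [elsym_lower] makes sigma_(m+2)
    larger than s. Index m + 1 is the coordinate lambda_k with k = m + 2. *)
Lemma middle_le eta : 0 < eta -> 1 <= L -> A <= L ->
  (2 ^+ n.+1 * A + s + 1) / eta ^+ m.+2 <= L -> lam (inord m.+1) <= eta * L.
Proof.
move=> eta0 L1 AL hL; rewrite leNgt; apply/negP => gt.
have L0 : 0 < L by apply: lt_le_trans L1.
have := @elsym_lower R _ lam A L A_gt0 AL lam_gtN le_lam0
  [set i : 'I_n.+1 | (i < m.+2)%N] (eta * L) m.+1.
rewrite card_initial_segment // card_ord sig => /(_ erefl (ltW (mulr_gt0 eta0 L0))).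
have -> : (eta * L) ^+ m.+2 - 2 ^+ n.+1 * (A * L ^+ m.+1)
   = (eta ^+ m.+2 * L - 2 ^+ n.+1 * A) * L ^+ m.+1.
  by rewrite exprMn [L ^+ m.+2]exprS; ring.
move=> h; have {h} : (eta ^+ m.+2 * L - 2 ^+ n.+1 * A) * L ^+ m.+1 <= s.
  apply: h => i; rewrite inE => im; apply: le_trans (ltW gt) (sorted _).
  by rewrite inordK.
have : s + 1 <= eta ^+ m.+2 * L - 2 ^+ n.+1 * A.
  have : 2 ^+ n.+1 * A + s + 1 <= L * eta ^+ m.+2 by rewrite -ler_pdivrMr ?exprn_gt0.
  rewrite lerBrDr [L * _]mulrC; apply: le_trans.
  by rewrite -[X in _ <= X]addrA [X in _ <= X]addrC.
have : 1 <= L ^+ m.+1 by apply: exprn_ege1.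
set X := _ - _; set Y := L ^+ _ => Y1 sX XY.
have : (s + 1) * 1 <= X * Y by apply: ler_pM => //; have := s_gt0; lra.
lra.
Qed.

(** The least b makes the coordinates of index 1 to b large; b <= m later leaves mu = m + 2 - b >=
    2. *)
Lemma gap (t : nat -> R) : lam (inord m.+1) <= t m.+1 * L ->
  exists b, [/\ (b <= m)%N, lam (inord b.+1) <= t b.+1 * L
    & forall b', (b' < b)%N -> t b'.+1 * L <= lam (inord b'.+1)].
Proof.
move=> hm; have ex : exists b, lam (inord b.+1) <= t b.+1 * L by exists m.
case: (ex_minnP ex) => b hb bmin; exists b; split => //; first exact: bmin.
by move=> b' lt; rewrite leNgt; apply/negP => /ltW /bmin; rewrite leqNgt lt.
Qed.

End Bounds.

Theorem lemma1p1 (R : realType) (k : nat) (hk : (2 <= k)%N) :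
  exists delta0 : R, 0 < delta0 /\
  exists K : R, 0 < K /\
  forall (n : nat), (k <= n.+1)%N ->
  forall (A s : R), 0 < A -> 0 < s ->
  exists C : R, 0 < C /\
  forall lam : 'I_n.+1 -> R,
    Gamma_cone k lam ->
    (forall i j : 'I_n.+1, (i <= j)%N -> lam j <= lam i) ->
    - A < lam ord_max ->
    sigma k lam = s ->
    C <= lam ord0 ->
  forall xi : 'I_n.+1 -> R,
    (1 + delta0) *
      (dsigma k ord0 lam * xi ord0 ^+ 2 / (lam ord0 * sigma k lam)) <=
    - (\sum_p \sum_(q | p != q)
         ddsigma k p q lam * xi p * xi q / sigma k lam)
    + K * ((\sum_i dsigma k i lam * xi i) ^+ 2 / sigma k lam ^+ 2)
    + 2 * (\sum_(i < n.+1 | (0 < i)%N)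
         dsigma k i lam * xi i ^+ 2 / ((lam ord0 + A + 1) * sigma k lam)).
Proof.
case: k hk => [|[|m]] // _; pose D : R := (2 * (m + 8))%:R.
have D1 : 0 < D - 1 by rewrite subr_gt0 ltr1n addnS mulnS.
exists (D - 1)^-1; split; first by rewrite invr_gt0.
exists 2; split=> // n mn A s A0 s0.
pose t := threshold R m n; have t_gt0 b : 0 < t b by apply: threshold_gt0.
have t_le1 b : t b <= 1 by apply: threshold_le1.
pose C0 := (2 ^+ n.+1 * A + s + 1) / t m.+1 ^+ m.+2.
have C00 : 0 <= C0.
  apply: divr_ge0; last by rewrite exprn_ge0 // ltW.
  have : 0 <= 2 ^+ n.+1 * A by apply: mulr_ge0; [apply: exprn_ge0 | apply: ltW].
  by move: s0; set X := 2 ^+ _ * _; lra.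
(* The term 16 (A + 1) makes L + A + 1 at most 17/16 L for [kapA]; C0 is what [middle_le]
   requires. *)
exists (1 + 16 * (A + 1) + C0); split; first lra.
move=> lam gam sorted lam_lo; rewrite sigma_elsym => sig CL xi.
set L := lam ord0 in CL.
have L0 : 0 < L by lra.
have mid : lam (inord m.+1) <= t m.+1 * L.
  apply: (@middle_le R n m A s lam) => //; rewrite -/L -/C0; lra.
have [b [bm hsmall hbig]] := gap mid.
have gT : gamma_on lam setT m.+2.
  move=> [|j] jm; first by rewrite elsym0.
  by rewrite -sigma_elsym; apply: gam.
pose B := [set i : 'I_n.+1 | (i < b.+1)%N] :\ ord0.
have bn : (b.+1 < n.+1)%N by apply: leq_ltn_trans mn.
have cB : #|B| = b.
  have := card_initial_segment (ltnW bn); rewrite (cardsD1 ord0) inE /=.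
  by rewrite -/B add1n => -[].
have BS : B \subset [set~ ord0] by apply/subsetP => i; rewrite !inE => /andP[].
pose eta := t b.+1; pose e := t b; pose u := eta / e.
have [eta0 eta16 eta9 etaZ] : [/\ 0 < eta, 16 * eta <= 1,
    9 * m.+1%:R * eta <= e & eta * err_total m n b e <= 1].
  exact: next_threshold_props.
have e0 : 0 < e := t_gt0 b.
have m0 : (0 : R) <= m%:R by [].
have u0 : 0 <= u by rewrite divr_ge0 // ltW.
have mu9 : 9 * m.+1%:R * u <= 1 by rewrite mulrA ler_pdivrMr // mul1r.
have u9 : 9 * u <= 1 - 9 * m%:R * u by move: mu9; rewrite -natr1; lra.
have u1 : u < 1 by have : 0 <= m%:R * u := mulr_ge0 m0 u0; lra.
have v0 : 0 < 1 - u by rewrite subr_gt0.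
(* A large coordinate is at least e L, so r = u e L is at most u times it. *)
pose kap := (1 - u)^-1.
have kap1 : 1 <= kap by rewrite invf_ge1 // gerBl.
have kap98 : kap ^+ b <= 9 / 8.
  rewrite exprVn -[9 / 8]invf_div lef_pV2 ?posrE ?exprn_gt0 //; last by lra.
  apply: le_trans (bernoulli b _); last by rewrite u0 ltW.
  have : b%:R * u <= m%:R * u by rewrite ler_wpM2r // ler_nat.
  lra.
pose r := eta * L.
have r0 : 0 <= r by rewrite mulr_ge0 // ltW.
have SN : (#|[set~ ord0 : 'I_n.+1]| <= n)%N by rewrite cardsC1 card_ord.
have Bmu : (#|B| + (m.+2 - b) = m.+2)%N.
  by rewrite cB subnKC // (leq_trans bm) // -addn2 leq_addr.
have mu1 : (1 < m.+2 - b)%N by rewrite ltn_subRL addn1 ltnS.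
have lam_le i : lam i <= L by apply: sorted.
have small i : i \in [set~ ord0] :\: B -> lam i <= r.
  rewrite !inE => /andP[iB i0]; apply: le_trans hsmall; apply: sorted.
  by rewrite inordK // leqNgt; apply: contraNN iB => ->; rewrite i0.
have big j : j \in B ->
    (e * L <= lam j <= L) && (lam j <= kap * (lam j - r)).
  rewrite !inE => /andP[j0 jb].
  have eL : e * L <= lam j.
    have : (0 < b)%N by case: (b) jb j0 => // j1; rewrite -val_eqE /= -lt0n; case: (val j) j1.
    rewrite /e; case: (b) hbig jb bn => // b' hbig' jb bn' _.
    apply: le_trans (hbig' b' (ltnSn _)) (sorted _ _ _).
    by rewrite inordK // ltnW.
  rewrite eL lam_le /= /kap mulrC ler_pdivlMr //.
  have : u * (e * L) <= u * lam j by rewrite ler_wpM2l.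
  have -> : u * (e * L) = r by rewrite /u /r; field; exact: lt0r_neq0.
  lra.
have kapA : 3 / 2 * kap ^+ #|B| * (L + A + 1) <= 2 * (L - r).
  have LA0 : 0 <= L + A + 1 by lra.
  have : kap ^+ #|B| * (L + A + 1) <= 9 / 8 * (L + A + 1).
    by rewrite cB ler_wpM2r.
  have : 16 * r <= L.
    by have := ler_wpM2r (ltW L0) eta16; rewrite /r; lra.
  lra.
have errD : (err n r e #|B| (3 / 2) + n%:R * r) * D <= L.
  have -> : (err n r e #|B| (3 / 2) + n%:R * r) * D = eta * err_total m n b e * L.
    by rewrite cB /err /err_total /r -/D; ring.
  by have := ler_wpM2r (ltW L0) etaZ; rewrite mul1r.
have := @concavity_estimate R _ lam xi ord0 m gT n r e kap A B _ SN BS Bmu mu1 r0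
  L0 e0 (t_le1 b) kap1 small big A0 kapA errD.
rewrite -/D sum_dsigma sum_ddsigma dsigma_elsym.
have -> // : \sum_(i in [set~ ord0]) elsym lam [set~ i] m.+1 * xi i ^+ 2
      / ((L + A + 1) * elsym lam setT m.+2)
   = \sum_(i < n.+1 | (0 < i)%N) dsigma m.+2 i lam * xi i ^+ 2
      / ((L + A + 1) * elsym lam setT m.+2).
apply: eq_big => [i|i _]; first by rewrite !inE -val_eqE /= -lt0n.
by rewrite dsigma_elsym.
Qed.
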